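(* Fix $a\in(0,\infty)$ and let $(\varepsilon_n)_{n\ge1}$ be any sequence in $[0,1]$ such that $\lim_{n\to\infty} n^{1/6}\varepsilon_n=\infty$. Let $F_n=\mathbf{1}_{\{|L_n|\ge a n^{2/3}\}}$, where $|L_n|$ is the number of vertices in the largest connected component of the critical Erdős–Rényi graph ER$(n,1/n)$. Then $(F_n)_{n\ge1}$ is quantitatively noise sensitive with scaling $\varepsilon_n$, that is, \[ \mathbb{E}[F_n(\omega)F_n(\omega_{\varepsilon_n})]-\mathbb{E}[F_n(\omega)]^2\to 0\qquad\text{as } n\to\infty . \]
   Context: Let $E_n$ be the edge set of the complete graph on $\{1,\dots,n\}$ and $\Omega_n=\{0,1\}^{E_n}$. A configuration $\omega\in\Omega_n$ is identified with the graph on $\{1,\dots,n\}$ whose edges are the $e$ with $\omega(e)=1$. Under $\mathbb{P}$ the coordinates $\omega(e)$ are independent and equal to $1$ with probability $p=1/n$ and $0$ otherwise, so $\omega$ is an ER$(n,1/n)$ random graph; $F_n$ is regarded as a function on $\Omega_n$. For $\varepsilon\in[0,1]$, $\omega_\varepsilon$ denotes the configuration obtained from $\omega$ by rerandomizing each bit independently with probability $\varepsilon$: $\omega_\varepsilon(e)=\omega(e)\mathbf{1}_{\{U_e>\varepsilon\}}+\mathbf{1}_{\{V_e<p\}}\mathbf{1}_{\{U_e\le\varepsilon\}}$, where $U_e,V_e$ ($e\in E_n$) are independent uniform random variables on $(0,1)$, independent of $\omega$. The expectation averages over both $\omega$ and the resampling. *)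

(* Defs.v *)
From HB Require Import structures.
From mathcomp Require Import all_boot all_order all_algebra.
From mathcomp Require Import all_classical all_reals all_analysis.
Set Implicit Arguments.
Unset Strict Implicit.
Unset Printing Implicit Defensive.
Import Order.TTheory GRing.Theory Num.Theory.
Import numFieldTopology.Exports numFieldNormedType.Exports.

Local Open Scope classical_set_scope.
Local Open Scope ring_scope.

Definition edge (n : nat) : Type := {e : {set 'I_n} | #|e| == 2%N}.

Definition config (n : nat) : Type := {ffun edge n -> bool}.

Definition adj (n : nat) (w : config n) : rel 'I_n :=
  fun i j => [exists e : edge n, w e && (val e == [set i; j]%SET)].

Definition component (n : nat) (w : config n) (v : 'I_n) : {set 'I_n} :=
  [set u | connect (adj w) v u]%SET.

Definition largest_component (n : nat) (w : config n) : nat :=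
  \max_(v < n) #|component w v|.

Definition large_component_indic (R : realType) (a : R) (n : nat)
    (w : config n) : R :=
  (a * n%:R `^ (2 / 3) <= (largest_component w)%:R)%R%:R.

Definition mutually_independent (R : realType) (d : measure_display)
    (T : measurableType d) (P : probability T R) (I : finType)
    (G : I -> set (set T)) : Prop :=
  forall (J : {set I}) (A : I -> set T),
    (forall i, i \in J -> G i (A i)) ->
    P (\bigcap_(i in [set` J]) A i) = (\prod_(i in J) P (A i))%E.

Definition sigma_of (d d' : measure_display) (T : measurableType d)
    (T' : measurableType d') (X : T -> T') : set (set T) :=
  preimage_set_system setT X measurable.

(* The variables omega_e, U_e, V_e take values in different spaces, so their
   joint independence is that of the sigma-algebras they generate, indexed by
   three copies of the edge set.  [uniform_prob] charges the closed unit interval,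
   which is the same law as the uniform one on the open interval. *)
Definition resampling_model (R : realType) (n : nat) (p : R)
    (d : measure_display) (T : measurableType d) (P : probability T R)
    (omega : edge n -> {RV P >-> bool}) (U V : edge n -> {RV P >-> R}) : Prop :=
  [/\ forall e, P (omega e @^-1` [set true]) = p%:E,
      forall e (B : set R), measurable B ->
        distribution P (U e) B = uniform_prob (@ltr01 R) B,
      forall e (B : set R), measurable B ->
        distribution P (V e) B = uniform_prob (@ltr01 R) B
    & mutually_independent P
        (fun i : edge n + edge n + edge n => match i with
           | inl (inl e) => sigma_of (omega e)
           | inl (inr e) => sigma_of (U e)
           | inr e => sigma_of (V e)
           end)].

Definition initial_config (R : realType) (n : nat) (d : measure_display)
    (T : measurableType d) (P : probability T R)
    (omega : edge n -> {RV P >-> bool}) (t : T) : config n :=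
  [ffun e => omega e t].

Definition noisy_config (R : realType) (n : nat) (p eps : R)
    (d : measure_display) (T : measurableType d) (P : probability T R)
    (omega : edge n -> {RV P >-> bool}) (U V : edge n -> {RV P >-> R})
    (t : T) : config n :=
  [ffun e => omega e t && (eps < U e t) || (V e t < p) && (U e t <= eps)].

(* Main.v *)
Require Import Defs.
From HB Require Import structures.
From mathcomp Require Import all_boot all_order all_algebra.
From mathcomp Require Import all_classical all_reals all_analysis.
From mathcomp Require Import measurable_realfun ring lra.
Set Implicit Arguments.
Unset Strict Implicit.
Unset Printing Implicit Defensive.
Import Order.TTheory GRing.Theory Num.Theory.
Import numFieldTopology.Exports numFieldNormedType.Exports.

Local Open Scope classical_set_scope.
Local Open Scope ring_scope.

(** Let [f] be the indicator that some component has at least [a * n ^ (2 / 3)]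
vertices. The proof bounds its noise covariance through the revealment of a
randomized algorithm, following Schramm and Steif.

The algorithm samples every vertex independently with probability
[q = K / n ^ (2 / 3)], explores the components of the sampled vertices, and
accepts if one of them is large. It never accepts wrongly, and it overlooks a large
component with probability at most [expR (- (a * K))] ([mean_hit_ge]). So its
acceptance probability [h w], as a function of the configuration, is uniformly close
to [f], and the covariances of [f] and [h] differ by little
([noise_covariance_perturb]).

A given edge is read with probability at most [delta = 2 * q * chi], where [chi]
bounds the mean size of a component ([revealment_le]). On the event that
a set [S] of edges stays unread, the output does not depend on the states of these
edges, hence is orthogonal to the character of [S]. This bounds the Fourier weight of
[h] on sets of size [k] by [k * delta] ([level_le]). Rerandomizing with probability [eps] multiplies
this weight by [(1 - eps) ^+ k], so that the covariance of [h] is at most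
[delta / eps ^+ 2] ([noise_covariance_le]).

It remains to show that [chi] is of order [n ^ (1 / 3)] ([mean_component_le]), which
makes [delta] of order [K * n ^ (- 1 / 3)], and [delta / eps ^+ 2] of order
[K / (n ^ (1 / 6) * eps) ^+ 2]; one lets [n] grow first and then [K]. Two estimates
are combined. Counting the edges read and the open edges found when exploring a
component [C] gives [E (#|C| * (#|C| + 1)) <= 2 * n] ([mean_component_sqr]).
Removing a vertex compares [C] with a critical Poisson tree, and gives
[E (1 - (1 - h) ^ #|C|)] of order at most [sqrt h] ([component_defect_le]). With
[h = n ^ (- 2 / 3)], the second controls the components of size up to [n ^ (2 / 3)]
and the first the larger ones.

The expectations over the probability spaces of the model reduce to finite sums over
configurations, because only finitely many independent binary tests are involved
([model_covariance]). *)

(** * Bernoulli product measures *)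

Section BernoulliMean.
Variables (R : realType) (I : finType) (p : R).
Implicit Types (w : {ffun I -> bool}) (i j : I) (S T : {set I}) (f g : {ffun I -> bool} -> R).

Definition bern (b : bool) : R := if b then p else 1 - p.

Definition weight w : R := \prod_i bern (w i).

Definition mean f : R := \sum_w weight w * f w.

Definition upd w i (b : bool) : {ffun I -> bool} :=
  [ffun j => if j == i then b else w j].

Definition free_of (A : Type) i (f : {ffun I -> bool} -> A) : Prop :=
  forall w b, f (upd w i b) = f w.

Lemma upd_upd w i b b' : upd (upd w i b) i b' = upd w i b'.
Proof. by apply/ffunP => j; rewrite !ffunE; case: eqP. Qed.

Lemma upd_id w i : upd w i (w i) = w.
Proof. by apply/ffunP => j; rewrite !ffunE; case: eqP => [->|]. Qed.

Lemma upd_at w i b : upd w i b i = b.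
Proof. by rewrite ffunE eqxx. Qed.

Lemma upd_other w i j b : j != i -> upd w i b j = w j.
Proof. by rewrite ffunE => /negbTE ->. Qed.

Lemma eq_mean f g : f =1 g -> mean f = mean g.
Proof. by move=> fg; apply: eq_bigr => w _; rewrite fg. Qed.

Lemma meanD f g : mean (fun w => f w + g w) = mean f + mean g.
Proof. by rewrite -big_split; apply: eq_bigr => w _; rewrite mulrDr. Qed.

Lemma meanZ c f : mean (fun w => c * f w) = c * mean f.
Proof. by rewrite big_distrr; apply: eq_bigr => w _ /=; rewrite mulrCA. Qed.

Lemma meanN f : mean (fun w => - f w) = - mean f.
Proof. by rewrite -sumrN; apply: eq_bigr => w _; rewrite mulrN. Qed.

Lemma meanB f g : mean (fun w => f w - g w) = mean f - mean g.
Proof. by rewrite meanD meanN. Qed.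

Lemma mean_sum (K : finType) (P : pred K) (F : K -> {ffun I -> bool} -> R) :
  mean (fun w => \sum_(k | P k) F k w) = \sum_(k | P k) mean (F k).
Proof.
rewrite exchange_big /=; apply: eq_bigr => w _.
by rewrite big_distrr.
Qed.

Lemma mean_cst c : mean (fun=> c) = c.
Proof.
rewrite /mean -big_distrl /= -[RHS]mul1r; congr (_ * _).
rewrite /weight -(bigA_distr_bigA (fun _ b => bern b)) big1 // => i _.
by rewrite big_bool /= addrC subrK.
Qed.

Definition swap_coord i w := upd w i (~~ w i).

Lemma swap_coordK i : involutive (swap_coord i).
Proof.
move=> w; rewrite /swap_coord upd_at upd_upd negbK upd_id //.
Qed.

Lemma mean_split i f :
  mean f = \sum_(w : {ffun I -> bool} | w i) (\prod_(j | j != i) bern (w j)) *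
             (p * f (upd w i true) + (1 - p) * f (upd w i false)).
Proof.
rewrite /mean (bigID (fun w => w i)) /= [X in _ + X](reindex_inj (inv_inj (swap_coordK i))) /=.
rewrite [X in _ + X](eq_bigl (fun w => w i)); last first.
  by move=> w; rewrite /swap_coord upd_at negbK.
rewrite -big_split /=; apply: eq_bigr => w wi.
have weightE v : weight v = bern (v i) * \prod_(j | j != i) bern (v j).
  by rewrite /weight (bigD1 i).
have restE : \prod_(j | j != i) bern (swap_coord i w j) = \prod_(j | j != i) bern (w j).
  by apply: eq_bigr => j ji; rewrite /swap_coord upd_other.
have wE : upd w i true = w by rewrite -wi upd_id.
rewrite !weightE restE /swap_coord upd_at wi /= wE.
by ring.
Qed.

(** This one-coordinate Fubini is the only form in which the independence of the
coordinates is used. *)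
Lemma mean_resample i f :
  mean f = mean (fun w => p * f (upd w i true) + (1 - p) * f (upd w i false)).
Proof.
rewrite (mean_split i) [RHS](mean_split i); apply: eq_bigr => w _.
by rewrite !upd_upd; congr (_ * _); ring.
Qed.

Lemma mean_coord i (phi : bool -> R) f : free_of i f ->
  mean (fun w => phi (w i) * f w) =
  (p * phi true + (1 - p) * phi false) * mean f.
Proof.
move=> fi; rewrite (mean_resample i) -meanZ; apply: eq_mean => w.
by rewrite !upd_at !fi; ring.
Qed.

(** Each factor sees [S] only through its own coordinate, so the coordinates can be
integrated out one after the other. *)
Lemma mean_prod S (F : I -> bool -> {ffun I -> bool} -> R) (a : {ffun I -> bool} -> R) :
  (forall i j b, i \in S -> j \in S -> free_of j (F i b)) ->
  (forall j, j \in S -> free_of j a) ->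
  mean (fun w => a w * \prod_(i in S) F i (w i) w) =
  mean (fun w => a w * \prod_(i in S) (p * F i true w + (1 - p) * F i false w)).
Proof.
elim: {S}_.+1 {-2}S (ltnSn #|S|) a => // m IH S; rewrite ltnS => leSm a FS aS.
have [->|/set0Pn[i iS]] := eqVneq S finset.set0.
  by apply: eq_mean => w; rewrite !big_set0.
pose a' w := a w * (p * F i true w + (1 - p) * F i false w).
have sub j : j \in (S :\ i)%SET -> j \in S by case/setD1P.
transitivity (mean (fun w => a' w * \prod_(j in S :\ i) F j (w j) w)).
  rewrite (mean_resample i); apply: eq_mean => w.
  rewrite !(big_setD1 i iS) /= !upd_at !FS // !aS //.
  have E b : \prod_(j in S :\ i) F j (upd w i b j) (upd w i b) =
             \prod_(j in S :\ i) F j (w j) w.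
    apply: eq_bigr => j jD; have jS := sub j jD.
    by rewrite upd_other; [exact: FS | case/setD1P: jD].
  by rewrite !E /a'; ring.
rewrite IH.
- by apply: eq_mean => w; rewrite [in RHS](big_setD1 i iS) /= /a' mulrA.
- by rewrite (leq_trans _ leSm) // [X in (_ < X)%N](cardsD1 i) iS.
- by move=> k j b kS jS; exact: FS (sub _ kS) (sub _ jS).
- by move=> j /sub jS w b; rewrite /a' aS // !FS.
Qed.

Section Positivity.
Hypothesis p01 : 0 <= p <= 1.

Lemma bern_ge0 b : 0 <= bern b.
Proof. by case/andP: p01 => p0 p1; case: b => //=; rewrite subr_ge0. Qed.

Lemma weight_ge0 w : 0 <= weight w.
Proof. by apply: prodr_ge0 => i _; apply: bern_ge0. Qed.

Lemma ler_mean f g : (forall w, f w <= g w) -> mean f <= mean g.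
Proof. by move=> fg; apply: ler_sum => w _; rewrite ler_wpM2l ?weight_ge0. Qed.

Lemma mean_ge0 f : (forall w, 0 <= f w) -> 0 <= mean f.
Proof. by move=> f0; rewrite -(mean_cst 0); apply: ler_mean. Qed.

End Positivity.

(** * The noise inequality of Schramm and Steif *)

Section Characters.
Variable phi : bool -> R.
Hypothesis phi_mean : p * phi true + (1 - p) * phi false = 0.
Hypothesis phi_var : p * phi true ^+ 2 + (1 - p) * phi false ^+ 2 = 1.

Definition chi S w : R := \prod_(i in S) phi (w i).

Lemma chi0 w : chi finset.set0 w = 1.
Proof. by rewrite /chi big_set0. Qed.

Lemma free_of_chi i S : i \notin S -> free_of i (chi S).
Proof.
move=> iS w b; apply: eq_bigr => j jS; rewrite upd_other //.
by apply: contraNneq iS => <-.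
Qed.

Lemma mean_chi (a : {ffun I -> bool} -> R) i S T : i \in S -> i \notin T ->
  free_of i a -> mean (fun w => a w * chi S w * chi T w) = 0.
Proof.
move=> iS iT ai.
transitivity (mean (fun w => phi (w i) * (a w * chi (S :\ i)%SET w * chi T w))).
  by apply: eq_mean => w; rewrite /chi (big_setD1 i iS) /=; ring.
rewrite mean_coord ?phi_mean ?mul0r // => w b.
by rewrite ai !free_of_chi // !inE eqxx.
Qed.

Lemma mean_chi_sqr (a : {ffun I -> bool} -> R) S :
  (forall i, i \in S -> free_of i a) ->
  mean (fun w => a w * chi S w * chi S w) = mean a.
Proof.
move=> aS; transitivity (mean (fun w => a w * \prod_(i in S) (phi (w i)) ^+ 2)).
  by apply: eq_mean => w; rewrite -mulrA -expr2 /chi prodrXl.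
rewrite (mean_prod (F := fun _ b _ => phi b ^+ 2)) //; apply: eq_mean => w.
by rewrite big1 ?mulr1 // => i _; rewrite phi_var.
Qed.

Section Revealment.
(* [D] indexes the outcomes of the extra randomness of an algorithm, with law
[nu]; under [s] the algorithm reads the coordinates in [J s w], a set which the
coordinates outside it cannot influence, and outputs [g s w]. *)
Variables (D : finType) (nu : D -> R).
Hypothesis nu_ge0 : forall s, 0 <= nu s.
Hypothesis nu_sum : \sum_s nu s = 1.
Variables (J : D -> {ffun I -> bool} -> {set I}) (g : D -> {ffun I -> bool} -> R).
Hypothesis stopping : forall s w i b, i \notin J s w ->
  J s (upd w i b) = J s w /\ g s (upd w i b) = g s w.
Hypothesis g_sqr : forall s w, g s w ^+ 2 <= 1.
Variable delta : R.
Hypothesis delta_gt0 : 0 < delta.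
Hypothesis p01 : 0 <= p <= 1.
Hypothesis reveal : forall i, \sum_s nu s * mean (fun w => (i \in J s w)%:R) <= delta.

Definition average w : R := \sum_s nu s * g s w.
Definition coef S : R := mean (fun w => average w * chi S w).
Definition level k : R := \sum_(S : {set I} | #|S| == k) coef S ^+ 2.
Definition level_fun k w : R := \sum_(S : {set I} | #|S| == k) coef S * chi S w.

Definition unread s S w : R := [disjoint S & J s w]%B%:R.

Definition unread_fun s k w : R :=
  \sum_(S : {set I} | #|S| == k) coef S * (unread s S w * chi S w).

Lemma stopping_disjoint s S w i b : i \in S -> [disjoint S & J s w]%B ->
  J s (upd w i b) = J s w /\ g s (upd w i b) = g s w.
Proof.
by move=> iS dis; apply: stopping; rewrite (disjointFr dis).
Qed.

Lemma unread_free s S i w b : i \in S ->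
  unread s S (upd w i b) = unread s S w.
Proof.
move=> iS; rewrite /unread; case: (boolP [disjoint S & J s w]%B) => [dis|ndis].
  by have [-> _] := stopping_disjoint b iS dis; rewrite dis.
case: (boolP [disjoint S & J s (upd w i b)]%B) => // dis; case/negP: ndis.
have [] := stopping_disjoint (w i) iS dis.
by rewrite upd_upd upd_id => -> _.
Qed.

(** A coordinate that is not read can be changed without changing what is read,
so on the event that [S] is unread nothing that the algorithm sees depends on [S]. *)
Lemma unread_mul_free (F : {set I} -> R -> R) s S i : i \in S ->
  free_of i (fun w => unread s S w * F (J s w) (g s w)).
Proof.
move=> iS w b; rewrite unread_free // /unread.
case: (boolP [disjoint S & J s w]%B) => [dis|]; last by rewrite !mul0r.
by have [-> ->] := stopping_disjoint b iS dis.
Qed.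

(** Two distinct sets of the same size are not nested, so one of the two characters
has a coordinate in [S] that the other lacks and that [A S T] ignores. It is here
that working level by level matters. *)
Lemma mean_level_pair k (A : {set I} -> {set I} -> {ffun I -> bool} -> R) :
  (forall S T i, i \in S -> free_of i (A S T)) ->
  mean (fun w => \sum_(S : {set I} | #|S| == k) \sum_(T : {set I} | #|T| == k)
    coef S * coef T * (A S T w * chi S w * chi T w)) =
  \sum_(S : {set I} | #|S| == k) coef S ^+ 2 * mean (A S S).
Proof.
move=> freeA; rewrite mean_sum; apply: eq_bigr => S /eqP Sk.
rewrite mean_sum (bigD1 S) ?Sk //= meanZ mean_chi_sqr //; last by move=> i; apply: freeA.
rewrite big1 ?addr0 ?expr2 // => T /andP[/eqP Tk TS].
rewrite meanZ.
have /subsetPn[i iS iT] : ~~ (S \subset T).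
  by apply: contra TS => ST; rewrite eq_sym eqEcard ST Tk Sk /=.
by rewrite (mean_chi iS iT) ?mulr0 //; apply: freeA.
Qed.

Lemma mean_g_unread s k : (0 < k)%N ->
  mean (fun w => g s w * unread_fun s k w) = 0.
Proof.
move=> k0; under eq_mean => w do rewrite big_distrr /=.
rewrite mean_sum big1 // => S /eqP Sk.
have /set0Pn[i iS] : S != finset.set0 by rewrite -card_gt0 Sk.
rewrite -(mulr0 (coef S)) -(@mean_chi (fun w => unread s S w * g s w) i S finset.set0) //.
- by rewrite -meanZ; apply: eq_mean => w; rewrite chi0; ring.
- by rewrite inE.
- exact: (@unread_mul_free (fun _ x => x)).
Qed.

Lemma mean_level_sqr k : mean (fun w => level_fun k w ^+ 2) = level k.
Proof.
transitivity (mean (fun w => \sum_(S : {set I} | #|S| == k) \sum_(T : {set I} | #|T| == k)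
    coef S * coef T * (1 * chi S w * chi T w))).
  apply: eq_mean => w; rewrite expr2 big_distrlr /=.
  by apply: eq_bigr => S _; apply: eq_bigr => T _; ring.
rewrite (@mean_level_pair k (fun _ _ _ => 1)) //.
by apply: eq_bigr => S _; rewrite mean_cst mulr1.
Qed.

Lemma mean_level_unread s k : mean (fun w => level_fun k w * unread_fun s k w) =
  \sum_(S : {set I} | #|S| == k) coef S ^+ 2 * mean (unread s S).
Proof.
rewrite -(@mean_level_pair k (fun S _ => unread s S)); last first.
  by move=> S T i iS w b; rewrite unread_free.
apply: eq_mean => w; rewrite mulrC big_distrlr /=.
by apply: eq_bigr => S _; apply: eq_bigr => T _; ring.
Qed.

Lemma mean_unread_sqr s k : mean (fun w => unread_fun s k w ^+ 2) =
  \sum_(S : {set I} | #|S| == k) coef S ^+ 2 * mean (unread s S).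
Proof.
transitivity (\sum_(S : {set I} | #|S| == k) coef S ^+ 2 *
    mean (fun w => unread s S w * unread s S w)).
  rewrite -(@mean_level_pair k (fun S T w => unread s S w * unread s T w)).
    apply: eq_mean => w; rewrite expr2 big_distrlr /=.
    by apply: eq_bigr => S _; apply: eq_bigr => T _; ring.
  by move=> S T i; apply: (@unread_mul_free (fun K _ => [disjoint T & K]%B%:R)).
apply: eq_bigr => S _; congr (_ * _); apply: eq_mean => w.
by rewrite /unread -natrM mulnb andbb.
Qed.

Lemma unread_lower s S w : 1 - \sum_(i in S) (i \in J s w)%:R <= unread s S w.
Proof.
rewrite /unread; case: (boolP [disjoint S & J s w]%B) => [_|].
  by rewrite gerBl sumr_ge0.
rewrite -setI_eq0 => /set0Pn[i]; rewrite inE => /andP[iS iJ].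
by rewrite (bigD1 i) //= iJ opprD addrA subrr sub0r oppr_le0 sumr_ge0.
Qed.

(** A union bound over the elements of [S]. *)
Lemma average_unread S : 1 - #|S|%:R * delta <= \sum_s nu s * mean (unread s S).
Proof.
apply: (@le_trans _ _ (\sum_s nu s * mean (fun w => 1 - \sum_(i in S) (i \in J s w)%:R))).
  under eq_bigr => s _ do rewrite meanB mean_cst mean_sum mulrBr mulr1 big_distrr /=.
  rewrite sumrB nu_sum lerD2l lerN2 exchange_big /= -sumr_const big_distrl /=.
  by apply: ler_sum => i _; rewrite mul1r.
apply: ler_sum => s _; rewrite ler_wpM2l // ler_mean // => w.
exact: unread_lower.
Qed.

Lemma mean_average f : mean (fun w => average w * f w) =
  \sum_s nu s * mean (fun w => g s w * f w).
Proof.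
under eq_mean => w do rewrite /average big_distrl /=.
rewrite mean_sum; apply: eq_bigr => s _; rewrite -meanZ; apply: eq_mean => w.
by rewrite mulrA.
Qed.

Lemma level_as_inner k : mean (fun w => average w * level_fun k w) = level k.
Proof.
under eq_mean => w do rewrite big_distrr /=.
rewrite mean_sum; apply: eq_bigr => S _.
under eq_mean => w do rewrite mulrCA.
by rewrite meanZ.
Qed.

(** The level-[k] part of [average] correlates with [g s] only through the
characters that [J s] reads; the part carried by unread characters is orthogonal
to [g s], and removing it leaves a function of square norm at most
[k * delta * level k]. Cauchy-Schwarz, in the form of a nonnegative square with
the optimal multiplier, then bounds [level k] by itself. *)
Lemma level_le k : (0 < k)%N -> level k <= k%:R * delta.
Proof.
move=> k0; set L := level k; set kd := k%:R * delta.
have kd0 : 0 < kd by rewrite mulr_gt0 // ltr0n.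
pose res s w := level_fun k w - unread_fun s k w.
have resE s : mean (fun w => res s w ^+ 2) = L -
    \sum_(S : {set I} | #|S| == k) coef S ^+ 2 * mean (unread s S).
  under eq_mean => w do rewrite /res sqrrB.
  rewrite meanD meanB mean_level_sqr mean_unread_sqr.
  under [X in _ - X + _]eq_mean => w do rewrite -mulr_natl.
  by rewrite meanZ mean_level_unread -/L; ring.
have res_le : \sum_s nu s * mean (fun w => res s w ^+ 2) <= kd * L.
  under eq_bigr => s _ do rewrite resE mulrBr [X in _ - X]big_distrr /=.
  rewrite sumrB -mulr_suml nu_sum mul1r exchange_big /= lerBlDr -lerBlDl.
  apply: (@le_trans _ _ (\sum_(S : {set I} | #|S| == k) coef S ^+ 2 * (1 - kd))).
    by rewrite -mulr_suml -/(level k) -/L; lra.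
  apply: ler_sum => S /eqP Sk.
  under eq_bigr => s _ do rewrite mulrCA.
  rewrite -mulr_sumr ler_wpM2l ?sqr_ge0 // /kd -Sk.
  exact: average_unread.
have inner : \sum_s nu s * mean (fun w => g s w * res s w) = L.
  rewrite -[RHS]level_as_inner mean_average; apply: eq_bigr => s _; congr (_ * _).
  under eq_mean => w do rewrite mulrBr.
  by rewrite meanB mean_g_unread // subr0.
have key t : 0 <= 1 - 2 * t * L + t ^+ 2 * (kd * L).
  have -> : 2 * t * L = \sum_s nu s * mean (fun w => 2 * t * (g s w * res s w)).
    rewrite -inner big_distrr /=; apply: eq_bigr => s _.
    by rewrite meanZ; ring.
  apply: (@le_trans _ _ (\sum_s nu s * mean (fun w => (g s w - t * res s w) ^+ 2))).
    by apply: sumr_ge0 => s _; rewrite mulr_ge0 // mean_ge0 // => w; rewrite sqr_ge0.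
  apply: (@le_trans _ _ (\sum_s nu s * mean (fun w => g s w ^+ 2) -
      \sum_s nu s * mean (fun w => 2 * t * (g s w * res s w)) +
      t ^+ 2 * \sum_s nu s * mean (fun w => res s w ^+ 2))).
    rewrite big_distrr /= -sumrB -big_split /=; apply: ler_sum => s _.
    have -> : mean (fun w => (g s w - t * res s w) ^+ 2) = mean (fun w => g s w ^+ 2)
        - mean (fun w => 2 * t * (g s w * res s w)) + t ^+ 2 * mean (fun w => res s w ^+ 2).
      by rewrite -meanB -meanZ -meanD; apply: eq_mean => w; ring.
    by rewrite le_eqVlt; apply/orP; left; apply/eqP; ring.
  rewrite lerD ?ler_wpM2l ?sqr_ge0 // lerD2r -nu_sum.
  apply: ler_sum => s _; rewrite -[leRHS]mulr1 ler_wpM2l //.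
  by rewrite -(mean_cst 1) ler_mean.
have := key kd^-1.
have -> : 1 - 2 * kd^-1 * L + kd^-1 ^+ 2 * (kd * L) = 1 - L / kd.
  by field; rewrite gt_eqF.
by rewrite subr_ge0 ler_pdivrMr // mul1r.
Qed.

(** * Noise stability *)

(** The partial sums have a closed form, which an induction verifies. *)
Lemma sum_geometric_deriv_le (x : R) n : 0 <= x < 1 ->
  \sum_(k < n) k%:R * x ^+ k <= (1 - x) ^- 2.
Proof.
move=> /andP[x0 x1]; have y0 : 0 < 1 - x by rewrite subr_gt0.
have E : (1 - x) ^+ 2 * (\sum_(k < n) k%:R * x ^+ k) =
    x - n%:R * x ^+ n + (n%:R - 1) * x ^+ n.+1.
  elim: n => [|m IH]; first by rewrite big_ord0 expr1 expr0; ring.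
  rewrite big_ord_recr /= mulrDr IH !exprS -natr1; ring.
rewrite -[leRHS]mul1r ler_pdivlMr ?exprn_gt0 // mulrC E.
case: n {E} => [|m]; first by rewrite expr0 expr1; lra.
have xm : 0 <= x ^+ m.+1 by rewrite exprn_ge0.
rewrite [x ^+ m.+2]exprS -natr1.
have : 0 <= m%:R * x ^+ m.+1 * (1 - x) by rewrite !mulr_ge0 ?ler0n // ltW.
lra.
Qed.

(** Density, with respect to two independent configurations, of a configuration
together with a copy of it having correlation [rho] in each coordinate. *)
Definition noise_density rho (w w' : {ffun I -> bool}) : R :=
  \prod_i (1 + rho * (phi (w i) * phi (w' i))).

(** Expanding the product shows that the characters diagonalize the noise. *)
Lemma noise_densityE rho w w' :
  noise_density rho w w' = \sum_(S : {set I}) rho ^+ #|S| * (chi S w * chi S w').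
Proof.
rewrite /noise_density; under eq_bigr => i _ do rewrite addrC.
rewrite bigA_distr; apply: eq_bigr => S _.
by rewrite -big_mkcond /= big_split /= prodr_const big_split.
Qed.

Lemma mean_noise_density rho w : mean (noise_density rho w) = 1.
Proof.
rewrite (eq_mean (noise_densityE rho w)) mean_sum (bigD1 finset.set0) //= big1 ?addr0.
  rewrite (@eq_mean _ (fun=> 1)) ?mean_cst // => w'.
  by rewrite cards0 expr0 !chi0 !mulr1.
move=> S /set0Pn[i iS]; rewrite !meanZ.
rewrite (@eq_mean _ (fun w' => 1 * chi S w' * chi finset.set0 w')); last first.
  by move=> w'; rewrite chi0 mulr1 mul1r.
by rewrite (@mean_chi (fun=> 1) i) ?inE // !mulr0.
Qed.

Definition noise_stability rho f : R :=
  mean (fun w => mean (fun w' => noise_density rho w w' * (f w * f w'))).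

Lemma noise_stabilityE rho f : noise_stability rho f =
  \sum_(S : {set I}) rho ^+ #|S| * mean (fun w => f w * chi S w) ^+ 2.
Proof.
transitivity (mean (fun w => \sum_(S : {set I}) rho ^+ #|S| *
    mean (fun w => f w * chi S w) * (f w * chi S w))).
  apply: eq_mean => w; under eq_mean => w' do rewrite noise_densityE big_distrl /=.
  rewrite mean_sum; apply: eq_bigr => S _.
  rewrite -mulrA [_ * (f w * _)]mulrC mulrA -meanZ; apply: eq_mean => w'; ring.
rewrite mean_sum; apply: eq_bigr => S _.
by rewrite meanZ expr2 mulrA.
Qed.

(** Level [k] has weight at most [k * delta] and is damped by [rho ^+ k]; the sum
of [k * rho ^+ k] is at most [(1 - rho) ^- 2]. *)
Lemma noise_covariance_le rho : 0 <= rho < 1 ->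
  0 <= noise_stability rho average - mean average ^+ 2 <= delta / (1 - rho) ^+ 2.
Proof.
move=> /andP[rho0 rho1].
have E : noise_stability rho average - mean average ^+ 2 =
    \sum_(S : {set I} | S != finset.set0) rho ^+ #|S| * coef S ^+ 2.
  rewrite noise_stabilityE (bigD1 finset.set0) //= cards0 expr0 mul1r.
  under eq_mean => w do rewrite chi0 mulr1.
  by rewrite [X in X - _]addrC addrK.
rewrite E sumr_ge0 /=; last by move=> S _; rewrite mulr_ge0 ?sqr_ge0 ?exprn_ge0.
have lt_card S : (#|S| < #|I|.+1)%N by rewrite ltnS max_card.
rewrite (partition_big (fun S => Ordinal (lt_card S)) predT) //=.
apply: (@le_trans _ _ (\sum_(k < #|I|.+1) delta * (k%:R * rho ^+ k))).
  apply: ler_sum => k _.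
  have ordE S : (Ordinal (lt_card S) == k) = (#|S| == k :> nat) by [].
  have [k0|k0] := posnP k.
    rewrite k0 mul0r mulr0 big_pred0 // => S.
    by rewrite ordE k0 cards_eq0; case: eqP.
  rewrite (eq_bigl (fun S : {set I} => #|S| == k)); last first.
    move=> S; rewrite ordE; case: (#|S| =P k :> nat) => [Sk|]; last by rewrite andbF.
    by rewrite -card_gt0 Sk k0.
  rewrite (eq_bigr (fun S : {set I} => rho ^+ k * coef S ^+ 2)); last by move=> S /eqP ->.
  rewrite -mulr_sumr -/(level k) [leRHS](_ : _ = rho ^+ k * (k%:R * delta)); last by ring.
  by rewrite ler_wpM2l ?exprn_ge0 // level_le.
rewrite -mulr_sumr ler_wpM2l ?(ltW delta_gt0) //.
by apply: sum_geometric_deriv_le; rewrite rho0.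
Qed.

End Revealment.

(** Both terms of the covariance are Lipschitz in the observable, because the
density is that of a probability. *)
Lemma noise_covariance_perturb rho f g eta : 0 <= p <= 1 ->
  (forall b b', 0 <= 1 + rho * (phi b * phi b')) ->
  (forall w, 0 <= g w) -> (forall w, g w <= f w) -> (forall w, f w <= 1) ->
  (forall w, f w - g w <= eta) ->
  `|noise_stability rho f - mean f ^+ 2 - (noise_stability rho g - mean g ^+ 2)| <= 2 * eta.
Proof.
move=> p01 density0 g0 gf f1 fg.
have f0 w : 0 <= f w by apply: le_trans (g0 w) (gf w).
have eta0 : 0 <= eta.
  by apply: le_trans (fg [ffun=> true]); rewrite subr_ge0.
have pair0 w w' : 0 <= noise_density rho w w' by apply: prodr_ge0.
have mass : mean (fun w => mean (fun w' => noise_density rho w w' * (2 * eta))) = 2 * eta.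
  rewrite -[RHS]mean_cst; apply: eq_mean => w.
  under eq_mean => w' do rewrite mulrC.
  by rewrite meanZ mean_noise_density mulr1.
have lipschitz (x x' y y' : R) : 0 <= y -> y <= x -> x <= 1 -> x - y <= eta ->
    0 <= y' -> y' <= x' -> x' <= 1 -> x' - y' <= eta -> 0 <= x * x' - y * y' <= 2 * eta.
  move=> y0 yx x1 xy y0' yx' x1' xy'.
  have -> : x * x' - y * y' = (x - y) * x' + y * (x' - y') by ring.
  apply/andP; split; first by rewrite addr_ge0 // mulr_ge0 ?subr_ge0 // (le_trans y0').
  have A : (x - y) * x' <= x - y by rewrite ler_piMr ?subr_ge0.
  have B : y * (x' - y') <= x' - y' by rewrite ler_piMl ?subr_ge0 // (le_trans yx).
  by lra.
have stab : 0 <= noise_stability rho f - noise_stability rho g <= 2 * eta.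
  rewrite /noise_stability -meanB.
  rewrite (@eq_mean _ (fun w => mean (fun w' =>
    noise_density rho w w' * (f w * f w' - g w * g w')))); last first.
    by move=> w; rewrite -meanB; apply: eq_mean => w'; rewrite mulrBr.
  apply/andP; split.
    apply: mean_ge0 => // w; apply: mean_ge0 => // w'; rewrite mulr_ge0 //.
    by case/andP: (lipschitz _ _ _ _ (g0 w) (gf w) (f1 w) (fg w) (g0 w') (gf w') (f1 w') (fg w')).
  rewrite -mass; apply: ler_mean => // w; apply: ler_mean => // w'; rewrite ler_wpM2l //.
  by case/andP: (lipschitz _ _ _ _ (g0 w) (gf w) (f1 w) (fg w) (g0 w') (gf w') (f1 w') (fg w')).
have mf1 : mean f <= 1 by rewrite -(mean_cst 1); apply: ler_mean.
have mg0 : 0 <= mean g by apply: mean_ge0.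
have mgf : mean g <= mean f by apply: ler_mean.
have mfg : mean f - mean g <= eta by rewrite -meanB -(mean_cst eta); apply: ler_mean.
have := lipschitz _ _ _ _ mg0 mgf mf1 mfg mg0 mgf mf1 mfg.
rewrite -!expr2 ler_norml; case/andP: stab => ? ? /andP[? ?].
by apply/andP; split; lra.
Qed.

End Characters.

(** The two values of a centred Bernoulli variable scaled to unit variance. *)
Definition bern_char (b : bool) : R :=
  if b then Num.sqrt ((1 - p) / p) else - Num.sqrt (p / (1 - p)).

Section BernoulliCharacter.
Hypothesis p0 : 0 < p.
Hypothesis p1 : p < 1.

Let q0 : 0 < 1 - p.
Proof. by rewrite subr_gt0. Qed.

Lemma bern_char_sqr b :
  bern_char b * bern_char b = if b then (1 - p) / p else p / (1 - p).
Proof.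
by case: b; rewrite /= ?mulrNN -expr2 sqr_sqrtr // divr_ge0 // ltW.
Qed.

Lemma bern_char_mixed b : bern_char b * bern_char (~~ b) = -1.
Proof.
have E : Num.sqrt ((1 - p) / p) * Num.sqrt (p / (1 - p)) = 1.
  rewrite -sqrtrM ?divr_ge0 ?(ltW p0) ?(ltW q0) // mulrA divfK ?divff ?sqrtr1 //.
    by rewrite gt_eqF.
  by rewrite gt_eqF.
by case: b; rewrite /= ?mulrN ?mulNr ?E // mulrC E.
Qed.

Lemma bern_char_var : p * bern_char true ^+ 2 + (1 - p) * bern_char false ^+ 2 = 1.
Proof. by rewrite !expr2 !bern_char_sqr; field; rewrite !gt_eqF. Qed.

Lemma bern_char_mean : p * bern_char true + (1 - p) * bern_char false = 0.
Proof.
have c0 : bern_char true != 0.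
  by rewrite /= gt_eqF // sqrtr_gt0 divr_gt0.
apply: (mulfI c0); rewrite mulr0 mulrDr !(mulrCA (bern_char true)).
by rewrite bern_char_sqr (bern_char_mixed true); field; rewrite gt_eqF.
Qed.

Lemma bern_density_ge0 rho b b' : 0 <= rho <= 1 ->
  0 <= 1 + rho * (bern_char b * bern_char b').
Proof.
move=> /andP[rho0 rho1]; have [->|bb'] := eqVneq b' b.
  rewrite addr_ge0 // mulr_ge0 // bern_char_sqr.
  by case: b; rewrite divr_ge0 // ltW.
have -> : b' = ~~ b by case: b b' bb' => [] [].
by rewrite bern_char_mixed mulrN1 subr_ge0.
Qed.

End BernoulliCharacter.
End BernoulliMean.

(** * Components of a finite graph *)

Section Components.
Variable n : nat.
Implicit Types (w : config n) (e : edge n) (u v x y : 'I_n) (A : {set 'I_n}).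

Lemma adjP w x y : reflect (exists2 e, w e & val e = [set x; y]%SET) (adj w x y).
Proof.
apply: (iffP existsP) => [[e /andP[we /eqP ee]]|[e we ee]]; first by exists e.
by exists e; rewrite we ee /=.
Qed.

Lemma edge_left e x y : val e = [set x; y]%SET -> x \in val e.
Proof. by move=> ->; rewrite !inE eqxx. Qed.

Lemma edge_right e x y : val e = [set x; y]%SET -> y \in val e.
Proof. by move=> ->; rewrite !inE eqxx orbT. Qed.

Lemma adj_sym w : symmetric (adj w).
Proof. by move=> x y; apply: eq_existsb => e; rewrite finset.setUC. Qed.

Lemma component_refl w v : v \in component w v.
Proof. by rewrite inE connect0. Qed.

Lemma component_sym w u v : (u \in component w v) = (v \in component w u).
Proof. by rewrite !inE; apply: sym_connect_sym; apply: adj_sym. Qed.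

Lemma component_step w v x y : x \in component w v -> adj w x y -> y \in component w v.
Proof. by rewrite !inE => vx xy; apply: connect_trans vx (connect1 xy). Qed.

Lemma component_min w v A : v \in A ->
  (forall x y, x \in component w v -> x \in A -> adj w x y -> y \in A) ->
  component w v \subset A.
Proof.
move=> vA closedA; apply/fintype.subsetP => u; rewrite inE => /connectP[s].
elim/last_ind: s u => [|s z IH] u /=; first by move=> _ ->.
rewrite rcons_path last_rcons => /andP[ps lz] ->.
apply: closedA lz; last exact: IH.
by rewrite inE; apply/connectP; exists s.
Qed.

Lemma component_eq w u v : u \in component w v -> component w u = component w v.
Proof.
rewrite inE => vu; apply/setP => x; rewrite !inE.
by rewrite (same_connect (sym_connect_sym (adj_sym w)) vu).
Qed.

(** The edges that an exploration of [A] reads. *)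
Definition touches A : {set edge n} := [set e : edge n | [exists x in A, x \in val e]]%SET.

Lemma touchesP A e : reflect (exists2 x, x \in A & x \in val e) (e \in touches A).
Proof. by rewrite inE; apply: exists_inP. Qed.

(** A component is found by reading only the edges that touch it. *)
Lemma component_local w w' v :
  (forall e, e \in touches (component w v) -> w' e = w e) ->
  component w' v = component w v.
Proof.
move=> agree; apply/eqP; rewrite finset.eqEsubset; apply/andP; split.
  apply: component_min (component_refl w v) _ => x y _ xC /adjP[e we ee].
  apply: (component_step xC); apply/adjP; exists e => //; rewrite -agree //.
  by apply/touchesP; exists x => //; apply: edge_left ee.
apply: component_min (component_refl w' v) _ => x y xC xC' /adjP[e we ee].
apply: (component_step xC'); apply/adjP; exists e => //; rewrite agree //.
by apply/touchesP; exists x => //; apply: edge_left ee.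
Qed.

Lemma component_upd w v e b : e \notin touches (component w v) ->
  component (upd w e b) v = component w v.
Proof.
move=> eT; apply: component_local => e' e'T; rewrite upd_other //.
by apply: contraNneq eT => <-.
Qed.

(** Reaching an endpoint of [e] never requires crossing [e] itself. *)
Lemma free_of_touches v e : free_of e (fun w => e \in touches (component w v)).
Proof.
have keep w b : e \notin touches (component w v) ->
    e \notin touches (component (upd w e b) v).
  by move=> eT; rewrite component_upd.
move=> w b; apply/idP/idP; first by apply: contraLR; apply: keep.
by apply: contraLR => /keep-/(_ (w e)); rewrite upd_upd upd_id.
Qed.

(** A tree is grown inside the component one vertex at a time, and each new vertex
brings an edge of its own. *)
Lemma component_edges w v :
  (#|component w v| <= #|[set e in touches (component w v) | w e]%SET|.+1)%N.
Proof.
set C := component w v.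
pose inner A := [set e : edge n | w e && (val e \subset A)]%SET.
have grow k : (k < #|C|)%N -> exists A, [/\ A \subset C, v \in A, #|A| = k.+1 &
    (#|A| <= #|inner A|.+1)%N].
  elim: k => [|k IH] kC.
    exists [set v]%SET; rewrite cards1 finset.set11; split=> //.
    by rewrite finset.sub1set component_refl.
  have [A [AC vA Ak Ainner]] := IH (ltnW kC).
  have nCA : ~~ (C \subset A).
    by apply/negP => /subset_leq_card; rewrite Ak leqNgt kC.
  have [x [y [xA yA xy]]] : exists x y, [/\ x \in A, y \notin A & adj w x y].
    move: nCA; apply: contraNP => none; apply: component_min vA _ => x y _ xA xy.
    by apply/negPn/negP => yA; apply: none; exists x, y.
  exists (y |: A)%SET; split.
  - rewrite finset.subUset finset.sub1set AC andbT.
    exact: component_step (fintype.subsetP AC _ xA) xy.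
  - by rewrite !inE vA orbT.
  - by rewrite cardsU1 yA Ak.
  rewrite cardsU1 yA add1n ltnS (leq_trans Ainner) //.
  have /adjP[e we ee] := xy.
  have eA : e \notin inner A.
    rewrite inE we /=; apply/negP => /fintype.subsetP /(_ y).
    by rewrite (negbTE yA) => /(_ (edge_right ee)).
  have <- : #|(e |: inner A)%SET| = #|inner A|.+1 by rewrite cardsU1 eA.
  apply: subset_leq_card; apply/fintype.subsetP => e'; rewrite !inE.
  case/predU1P => [->|/andP[we' e'A]].
    rewrite we ee finset.subUset !finset.sub1set !inE xA eqxx orbT //.
  by rewrite we' (fintype.subset_trans e'A) // finset.subsetUr.
have C0 : (0 < #|C|)%N by apply/card_gt0P; exists v; apply: component_refl.
have [|A [AC vA Ak]] := grow #|C|.-1; first by rewrite prednK.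
have -> : A = C by apply/eqP; rewrite eqEcard AC Ak prednK /=.
move=> /leq_trans; apply; rewrite ltnS.
apply: subset_leq_card; apply/fintype.subsetP => e; rewrite inE => /andP[we eC].
rewrite inE we andbT; apply/touchesP.
have /card_gt0P[x xe] : (0 < #|val e|)%N by rewrite (eqP (valP e)).
by exists x => //; apply: (fintype.subsetP eC).
Qed.

Lemma card_edges_within A : #|[set e : edge n | val e \subset A]%SET| = 'C(#|A|, 2).
Proof.
rewrite -(cards_draws A 2) -(card_imset _ val_inj).
apply: eq_card => B; apply/imsetP/idP => [[e eA ->]|].
  by move: eA; rewrite !inE => ->; apply: (valP e).
rewrite inE => /andP[BA B2]; exists (exist _ B B2 : edge n) => //.
by rewrite inE.
Qed.

Lemma bin2_ring (R : realType) m : 2 * 'C(m, 2)%:R = m%:R * (m%:R - 1) :> R.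
Proof.
elim: m => [|m IH]; first by rewrite bin0n mulr0 mul0r.
by rewrite binS bin1 natrD mulrDr IH -natr1; ring.
Qed.

Lemma card_touches (R : realType) A :
  2 * #|touches A|%:R = #|A|%:R * (2 * n%:R - #|A|%:R - 1) :> R.
Proof.
have E : (#|touches A| + 'C(#|~: A|%SET, 2) = 'C(n, 2))%N.
  have -> : 'C(n, 2) = #|{: edge n}|.
    rewrite -[X in 'C(X, 2)](card_ord n) -cardsT -card_edges_within -cardsT.
    by apply: eq_card => e; rewrite !inE finset.subsetT.
  rewrite -card_edges_within -(finset.cardsC (touches A)); congr (_ + _)%N.
  apply: eq_card => e; rewrite !inE; apply/idP/idP => [eA|].
    apply/exists_inPn => x xA; apply/negP => xe.
    by have := fintype.subsetP eA x xe; rewrite inE xA.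
  move/exists_inPn => eA; apply/fintype.subsetP => x xe; rewrite inE.
  by apply/negP => /eA; rewrite xe.
have := congr1 (fun k => 2 * k%:R : R) E; rewrite natrD mulrDr !bin2_ring.
have /(congr1 (fun k => k%:R : R)) := finset.cardsC A; rewrite natrD card_ord => <-.
move=> H; apply/eqP; rewrite -subr_eq0; apply/eqP; move: H; lra.
Qed.

End Components.

(** * The mean size of a critical component *)

Lemma sum_mem_card (R : realType) (T : finType) (A : {set T}) :
  \sum_x (x \in A)%:R = #|A|%:R :> R.
Proof.
rewrite -natr_sum -sum1_card [in RHS]big_mkcond /=; congr _%:R.
Qed.

Section MeanComponent.
Variables (R : realType) (n : nat).
Hypothesis n_gt1 : (1 < n)%N.
Implicit Types (w : config n) (e : edge n) (u v : 'I_n) (x : R).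

Let p : R := n%:R^-1.

Let n_gt0 : 0 < n%:R :> R.
Proof. by rewrite ltr0n ltnW. Qed.

Let n_neq0 : n%:R != 0 :> R.
Proof. by rewrite gt_eqF. Qed.

Lemma inv_nat01 : 0 <= p <= 1.
Proof. by rewrite /p invr_ge0 ler0n invf_le1 // ler1n ltnW. Qed.

Local Notation csize v w := (#|component w v|%:R : R).

(** Since an edge is open independently of the event that it touches the component,
the mean number of open edges found is [p] times the mean number of edges read.
The former is at least the mean size minus one, while an exploration of [c]
vertices reads [c * n - c * (c + 1) / 2] edges. At [p = 1 / n] the terms of first
order cancel and what remains bounds the second moment. *)
Lemma mean_component_sqr v : mean p (fun w => csize v w * (csize v w + 1)) <= 2 * n%:R.
Proof.
pose T w := touches (component w v).
pose open w := \sum_(e in T w) (w e)%:R : R.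
have openE : mean p open = p * mean p (fun w => #|T w|%:R).
  transitivity (mean p (fun w => \sum_e (w e)%:R * (e \in T w)%:R)).
    apply: eq_mean => w; rewrite /open big_mkcond; apply: eq_bigr => e _.
    by case: (e \in T w); rewrite ?mulr1 ?mulr0.
  rewrite mean_sum -meanZ.
  transitivity (\sum_e mean p (fun w => p * (e \in T w)%:R)).
    apply: eq_bigr => e _; rewrite meanZ.
    rewrite (@mean_coord R _ p e (fun b => b%:R) (fun w => (e \in T w)%:R)).
      by rewrite mulr1 mulr0 addr0.
    by move=> w b; rewrite /T free_of_touches.
  rewrite -mean_sum; apply: eq_mean => w.
  by rewrite -mulr_sumr sum_mem_card.
have open_ge w : csize v w - 1 <= open w.
  have := component_edges w v.
  rewrite -(ler_nat R) -natr1 -lerBlDr => /le_trans; apply.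
  rewrite -sum_mem_card /open [leRHS]big_mkcond /= ler_sum // => e _.
  by rewrite inE; case: (e \in T w); case: (w e).
have cardT w : #|T w|%:R = n%:R * csize v w - csize v w * (csize v w + 1) / 2 :> R.
  by have := card_touches R (component w v); rewrite -/(T w); lra.
have : mean p (fun w => csize v w - 1) <= mean p open.
  by apply: ler_mean => //; apply: inv_nat01.
rewrite openE (@eq_mean _ _ p (fun w => #|T w|%:R)
  (fun w => n%:R * csize v w - 2^-1 * (csize v w * (csize v w + 1)))).
  rewrite !meanB !meanZ mean_cst mulrBr mulrA mulVf // mul1r lerD2l lerN2.
  by rewrite mulrA -invfM mulrC ler_pdivrMr ?mulr_gt0 // mul1r mulrC.
by move=> w; rewrite cardT; ring.
Qed.

Definition delete w v : config n := [ffun e => w e && (v \notin val e)].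

(** The vertices that [v] can reach through the edge [e] without coming back to [v]. *)
Definition branch v e w : {set 'I_n} :=
  (\bigcup_(u in val e :\ v) component (delete w v) u)%SET.

Definition edges_at v : {set edge n} := [set e : edge n | v \in val e]%SET.

Lemma component_delete w v u : component (delete w v) u \subset component w u.
Proof.
apply: component_min (component_refl w u) _ => x y _ xC /adjP[e].
rewrite ffunE => /andP[we _] ee; apply: (component_step xC).
by apply/adjP; exists e.
Qed.

Lemma component_branches w v : component w v \subset
  (v |: \bigcup_(e in edges_at v | w e) branch v e w)%SET.
Proof.
apply: component_min; first by rewrite finset.in_setU1 eqxx.
move=> x y _ xB xy; rewrite finset.in_setU1; have [//|yv /=] := eqVneq y v.
have /adjP[e we ee] := xy.
have [xv|xv] := eqVneq x v.
  apply/finset.bigcupP; exists e.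
    by rewrite inE we andbT -xv (edge_left ee).
  apply/finset.bigcupP; exists y; last exact: component_refl.
  by rewrite !inE yv (edge_right ee).
move: xB; rewrite finset.in_setU1 (negbTE xv) /= => /finset.bigcupP[f fv].
move=> /finset.bigcupP[u uf xu].
apply/finset.bigcupP; exists f => //; apply/finset.bigcupP; exists u => //.
apply: (component_step xu); apply/adjP; exists e => //.
by rewrite ffunE we ee !inE negb_or ![v == _]eq_sym xv yv.
Qed.

Lemma card_component_branches w v :
  (#|component w v| <= 1 + \sum_(e in edges_at v | w e) #|branch v e w|)%N.
Proof.
apply: leq_trans (subset_leq_card (component_branches w v)) _.
apply: leq_trans (leq_card_setU _ _) _; rewrite cards1 leq_add2l.
apply: (big_ind2 (fun (A : {set 'I_n}) m => #|A| <= m)%N) => //.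
- by rewrite cards0.
- move=> A a B b Aa Bb; apply: leq_trans (leq_card_setU _ _) _.
  exact: leq_add.
Qed.

Lemma card_branch v e : e \in edges_at v ->
  exists u, forall w, (#|branch v e w| <= #|component w u|)%N.
Proof.
rewrite inE => ve.
have /cards1P[u eu] : #|(val e :\ v)%SET| == 1%N.
  by have := eqP (valP e); rewrite (cardsD1 v) ve add1n => -[->].
exists u => w; rewrite /branch eu finset.big_set1.
exact: subset_leq_card (component_delete w v u).
Qed.

Lemma card_edges_at v : (#|edges_at v| <= n.-1)%N.
Proof.
rewrite -(card_imset _ val_inj).
apply: (@leq_trans #|[set [set v; u]%SET | u in ~: [set v]]%SET|); last first.
  by apply: leq_trans (leq_imset_card _ _) _; rewrite cardsC1 card_ord.
apply: subset_leq_card; apply/fintype.subsetP => _ /imsetP[e ve ->].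
rewrite inE in ve; apply/imsetP.
have /cards1P[u eu] : #|(val e :\ v)%SET| == 1%N.
  by have := eqP (valP e); rewrite (cardsD1 v) ve add1n => -[->].
exists u; first by have := finset.set11 u; rewrite -eu !inE => /andP[].
by rewrite -eu finset.setD1K.
Qed.

Lemma free_of_branch v e e' : e' \in edges_at v -> free_of e' (branch v e).
Proof.
rewrite inE => ve' w b; rewrite /branch (_ : delete _ _ = delete w v) //.
apply/ffunP => f; rewrite !ffunE; case: eqP => [->|//].
by rewrite ve' !andbF.
Qed.

(** The ratio [p / (1 - p)] is [1 / (n - 1)], which makes the exponents of the
[n - 1] edges at a vertex add up to an average. *)
Lemma bernoulli_exp_le (y : R) : 0 <= y <= 1 ->
  expR (- (y / (n%:R - 1))) <= 1 - p * y.
Proof.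
move=> /andP[y0 y1].
have n1 : 0 < n%:R - 1 :> R by rewrite subr_gt0 ltr1n.
set t := y / (n%:R - 1).
have py : p * y = t * (n%:R - 1) / n%:R.
  by rewrite /p /t; field; rewrite n_neq0 gt_eqF.
have t0 : 0 <= t by rewrite divr_ge0 // ltW.
have E : 1 <= (1 - p * y) * (1 + t).
  have -> : (1 - p * y) * (1 + t) = 1 + t * (1 - y) / n%:R.
    by rewrite /p /t; field; rewrite n_neq0 gt_eqF.
  by rewrite lerDl divr_ge0 // mulr_ge0 // subr_ge0.
have py0 : 0 <= 1 - p * y.
  rewrite subr_ge0; apply: mulr_ile1 => //; by case/andP: inv_nat01.
rewrite expRN -[leLHS]mul1r ler_pdivrMr ?expR_gt0 //.
by rewrite (le_trans E) // ler_wpM2l // expR_ge1Dx.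
Qed.

(** The edges at [v] are independent of the graph without [v], in which components
are smaller; so a uniform bound [M] on the defects [1 - x ^+ #|C|] is fed into the
generating function of a critical Poisson tree, by convexity of the exponential. *)
Lemma component_gf_ge v x M : 0 <= x <= 1 ->
  (forall u, mean p (fun w => 1 - x ^+ #|component w u|) <= M) ->
  x * expR (- M) <= mean p (fun w => x ^+ #|component w v|).
Proof.
move=> /andP[x0 x1] defect.
pose F e (b : bool) w := if b then x ^+ #|branch v e w| else 1.
pose Y e w := 1 - x ^+ #|branch v e w|.
pose Z w := \sum_(e in edges_at v) Y e w / (n%:R - 1).
have n1 : 0 < n%:R - 1 :> R by rewrite subr_gt0 ltr1n.
have Y01 e w : 0 <= Y e w <= 1.
  by rewrite /Y subr_ge0 lerBlDr lerDl exprn_ile1 // exprn_ge0.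
have meanZ_le : mean p Z <= M.
  rewrite mean_sum; apply: (@le_trans _ _ (\sum_(e in edges_at v) M / (n%:R - 1))).
    apply: ler_sum => e ve.
    under eq_mean => w do rewrite mulrC.
    rewrite meanZ mulrC ler_wpM2r ?invr_ge0 ?(ltW n1) //.
    have [u branch_u] := card_branch ve.
    apply: le_trans (defect u); apply: (ler_mean inv_nat01) => w.
    by rewrite lerD2l lerN2 ler_wiXn2l.
  have M0 : 0 <= M.
    apply: le_trans (defect v); apply: (mean_ge0 inv_nat01) => w.
    by rewrite subr_ge0 exprn_ile1.
  rewrite sumr_const -[leLHS]mulr_natr mulrAC -mulrA -[leRHS]mulr1 ler_wpM2l //.
  rewrite ler_pdivrMr // mul1r (@le_trans _ _ n.-1%:R) ?ler_nat ?card_edges_at //.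
  by rewrite -subn1 natrB // ltnW.
apply: (@le_trans _ _ (mean p (fun w => x * \prod_(e in edges_at v) F e (w e) w))); last first.
  apply: (ler_mean inv_nat01) => w.
  apply: le_trans (ler_wiXn2l x0 x1 (card_component_branches w v)).
  rewrite exprD expr1 ler_wpM2l // expr_sum big_mkcondr /=.
  by apply: ler_prod => e _; rewrite /F; case: (w e); rewrite ?exprn_ge0 ?lexx ?ler01.
rewrite mean_prod //; last first.
  by move=> e e' b _ ve' w c; rewrite /F free_of_branch.
apply: (@le_trans _ _ (mean p (fun w => x * (expR (- M) * (1 + M - Z w))))); last first.
  apply: (ler_mean inv_nat01) => w; rewrite ler_wpM2l //.
  apply: (@le_trans _ _ (expR (- Z w))).
    rewrite -[X in _ <= expR X](_ : - M + (M - Z w) = - Z w); last by ring.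
    by rewrite expRD ler_wpM2l ?expR_ge0 // -addrA expR_ge1Dx.
  rewrite /Z -sumrN expR_sum; apply: ler_prod => e ve.
  rewrite expR_ge0 /=.
  have -> : p * F e true w + (1 - p) * F e false w = 1 - p * Y e w.
    rewrite /F /Y; move: (x ^+ _) => y.
    by ring.
  exact: bernoulli_exp_le.
rewrite !meanZ meanB mean_cst ler_wpM2l // ler_peMr ?expR_ge0 //.
by rewrite -addrA lerDl subr_ge0.
Qed.

(** At the vertex with the largest defect [M], the bound of the previous lemma reads
[(1 - h) * expR (- M) <= 1 - M]. As [expR (- M)] exceeds [1 - M] by an amount of
order [M ^+ 2], this forces [M ^+ 2] to be of order [h]. *)
Lemma component_defect_le (h : R) : 0 <= h <= 1 -> exists M,
  [/\ 0 <= M, M ^+ 2 * (1 - h) <= 4 * h &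
   forall v, mean p (fun w => 1 - (1 - h) ^+ #|component w v|) <= M].
Proof.
move=> /andP[h0 h1].
pose m v := mean p (fun w => 1 - (1 - h) ^+ #|component w v|).
have x01 : 0 <= 1 - h <= 1 by apply/andP; split; lra.
have x0 : 0 <= 1 - h by case/andP: x01.
case: (@arg_maxP _ _ 'I_n (Ordinal (ltnW n_gt1)) xpredT m) => // v _ max_v.
have M0 : 0 <= m v.
  apply: (mean_ge0 inv_nat01) => w; rewrite subr_ge0 exprn_ile1 //.
  by case/andP: x01.
exists (m v); split=> // [|u]; last exact: max_v.
have := @component_gf_ge v _ (m v) x01 (fun u => max_v u isT).
have -> : mean p (fun w => (1 - h) ^+ #|component w v|) = 1 - m v.
  by rewrite /m meanB mean_cst subKr.
set M := m v in M0 *; move=> fixpoint.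
have M1 : M <= 1.
  by rewrite -subr_ge0 (le_trans _ fixpoint) // mulr_ge0 ?expR_ge0.
have expM : (1 - M / 2) ^+ 2 <= expR (- M).
  have -> : - M = - (M / 2) + - (M / 2) by lra.
  rewrite expRD -expr2 lerXn2r ?nnegrE ?expR_ge0 //; first by lra.
  exact: expR_ge1Dx.
have := le_trans (ler_wpM2l x0 expM) fixpoint.
have : 0 <= h * M by rewrite mulr_ge0.
by nra.
Qed.

Lemma expr_one_sub_le (h : R) k : 0 <= h <= 1 ->
  (1 - h) ^+ k <= 1 - h * k%:R + h ^+ 2 * (k%:R * (k%:R - 1) / 2).
Proof.
move=> /andP[h0 h1]; elim: k => [|k IH]; first by rewrite expr0; lra.
have x0 : 0 <= 1 - h by lra.
rewrite exprS; apply: le_trans (ler_wpM2l x0 IH) _.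
have [->|k0] := posnP k; first by lra.
have kk : 0 <= k%:R * (k%:R - 1) :> R by rewrite mulr_ge0 ?subr_ge0 ?ler1n.
have : 0 <= h ^+ 3 * (k%:R * (k%:R - 1)) by rewrite mulr_ge0 ?exprn_ge0.
have -> : k.+1%:R = k%:R + 1 :> R by rewrite natr1.
by lra.
Qed.

(** Sizes up to [r ^+ 2] are controlled by the defect at [h = r ^- 2], and larger
sizes by the second moment; the two contributions balance at order [r]. *)
Lemma mean_component_le v (r : R) : 0 < r -> r ^+ 3 = n%:R -> 2 <= r ^+ 2 ->
  mean p (fun w => csize v w) <= 4 * r.
Proof.
move=> r0 r3 r2; pose h : R := r ^- 2.
have rn0 : r != 0 by rewrite gt_eqF.
have h0 : 0 <= h by rewrite invr_ge0 exprn_ge0 // ltW.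
have h2 : h <= 2^-1 by rewrite lef_pV2 ?posrE ?exprn_gt0.
have h01 : 0 <= h <= 1 by rewrite h0 /=; lra.
have [M [M0 M2 defect]] := component_defect_le h01.
have Mr : M <= 3 / r.
  rewrite -(@ler_pXn2r _ 2) ?nnegrE ?divr_ge0 ?(ltW r0) //.
  rewrite exprMn exprVn -/h; nra.
apply: (@le_trans _ _ (mean p (fun w => r ^+ 2 * (1 - (1 - h) ^+ #|component w v|) +
    (h / 2) * (csize v w * (csize v w + 1))))).
  apply: (ler_mean inv_nat01) => w; have := expr_one_sub_le #|component w v| h01.
  set c := #|component w v|; set X := _ ^+ c => cX.
  have rh : r ^+ 2 * h = 1 by rewrite /h divff // expf_neq0.
  have := ler_wpM2l (ltW (exprn_gt0 2 r0)) cX.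
  have -> : r ^+ 2 * (1 - h * c%:R + h ^+ 2 * (c%:R * (c%:R - 1) / 2)) =
      r ^+ 2 - (r ^+ 2 * h) * c%:R + (r ^+ 2 * h) * h * (c%:R * (c%:R - 1) / 2).
    by ring.
  rewrite rh; have : 0 <= h * c%:R by rewrite mulr_ge0.
  lra.
rewrite meanD !meanZ.
have := ler_wpM2l (ltW (exprn_gt0 2 r0)) (le_trans (defect v) Mr).
have h20 : 0 <= h / 2 by rewrite divr_ge0.
have := ler_wpM2l h20 (mean_component_sqr v).
have -> : h / 2 * (2 * n%:R) = r by rewrite -r3 /h; field.
have -> : r ^+ 2 * (3 / r) = 3 * r by field.
lra.
Qed.

End MeanComponent.

(** * Exploring from a sparse random set of vertices *)

Section Sampling.
Variables (R : realType) (n : nat) (theta : R).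
Implicit Types (w : config n) (e : edge n) (v : 'I_n) (s : {ffun 'I_n -> bool}).

Definition giant w : bool := theta <= (largest_component w)%:R.

Definition giant_indic w : R := (giant w)%:R.

Definition hit s w : bool := [exists v, s v && (theta <= #|component w v|%:R)].

Definition explored s w : {set edge n} :=
  (\bigcup_(v | s v) touches (component w v))%SET.

Lemma hit_stopping s w e b : e \notin explored s w ->
  explored s (upd w e b) = explored s w /\ hit s (upd w e b) = hit s w.
Proof.
move=> eJ; have same v : s v -> component (upd w e b) v = component w v.
  move=> sv; apply: component_upd; apply: contra eJ => eT.
  by apply/finset.bigcupP; exists v.
split; first by apply: eq_bigr => v /same ->.
by apply: eq_existsb => v; case: (boolP (s v)) => // /same ->.
Qed.

Lemma hit_giant s w : hit s w -> giant w.
Proof.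
case/existsP => v /andP[_ /le_trans]; apply.
by rewrite ler_nat (bigop.leq_bigmax v).
Qed.

(** All vertices of one large component are missed by a failed search, so the
failure is no likelier than a sample avoiding that component. *)
Lemma mean_hit_ge q w : 0 <= q <= 1 -> 0 < theta -> giant w ->
  1 - expR (- (q * theta)) <= mean q (fun s => (hit s w)%:R).
Proof.
move=> q01 theta0 gw; have /andP[q0 q1] := q01.
have [v bigv] : exists v, theta <= #|component w v|%:R.
  have [|n0] := posnP n.
    move=> n0; move: gw; rewrite /giant /largest_component big1 => [|i]; last first.
      by have := ltn_ord i; rewrite {2}n0.
    by rewrite leNgt theta0.
  have I0 : (0 < #|'I_n|)%N by rewrite card_ord.
  have [v vE] := bigop.eq_bigmax (fun v => #|component w v|) I0.
  by exists v; rewrite -vE.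
set B := component w v in bigv.
have missed s : 1 - \prod_(u in B) (if s u then 0 else 1) <= (hit s w)%:R :> R.
  case: (boolP (hit s w)) => [_|nhit].
    by rewrite lerBlDr lerDl prodr_ge0 // => u _; case: (s u).
  rewrite big1 ?subrr // => u uB; case: ifP => // su; case/negP: nhit.
  by apply/existsP; exists u; rewrite su (component_eq uB).
apply: le_trans (ler_mean q01 missed).
rewrite meanB mean_cst lerD2l lerN2.
have -> : mean q (fun s => \prod_(u in B) (if s u then 0 else 1)) = (1 - q) ^+ #|B| :> R.
  (* The constant factor 1 brings the mean into the shape of [mean_prod]. *)
  transitivity (mean q (fun s => 1 * \prod_(u in B) (if s u then 0 else 1) : R)).
    by apply: eq_mean => s; rewrite mul1r.
  rewrite (@mean_prod _ _ q B (fun u b _ => if b then 0 else 1) (fun=> 1)) //.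
  rewrite (@eq_mean _ _ q _ (fun=> (1 - q) ^+ #|B|)) ?mean_cst // => s.
  by rewrite mulr0 add0r mulr1 mul1r prodr_const.
have q1' : 0 <= 1 - q by rewrite subr_ge0.
apply: (@le_trans _ _ (expR (- q) ^+ #|B|)).
  by rewrite lerXn2r ?nnegrE ?expR_ge0 // expR_ge1Dx.
by rewrite -expRM_natr ler_expR mulNr lerN2 ler_wpM2l.
Qed.

Lemma mem_explored s w e : (e \in explored s w)%:R <=
  \sum_(x in val e) \sum_v (s v)%:R * (v \in component w x)%:R :> R.
Proof.
case: (boolP (e \in explored s w)) => [/finset.bigcupP[v sv /touchesP[x xC xe]]|_].
  rewrite (bigD1 x) //= (bigD1 v) //= sv component_sym xC mulr1 -addrA lerDl.
  by rewrite addr_ge0 // !sumr_ge0 // => *; rewrite ?sumr_ge0 // => *; rewrite mulr_ge0.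
by rewrite !sumr_ge0 // => *; rewrite sumr_ge0 // => *; rewrite mulr_ge0.
Qed.

(** By symmetry of connectedness, the sampled vertices whose component contains an
endpoint [x] of [e] are those sampled in the component of [x]. *)
Lemma revealment_le p q chi e : 0 <= p <= 1 -> 0 <= q <= 1 ->
  (forall v, mean p (fun w => #|component w v|%:R) <= chi) ->
  \sum_s weight q s * mean p (fun w => (e \in explored s w)%:R) <= 2 * q * chi :> R.
Proof.
move=> p01 q01 chi_ge; have /andP[q0 q1] := q01.
apply: (@le_trans _ _ (\sum_s weight q s * mean p (fun w =>
    \sum_(x in val e) \sum_v (s v)%:R * (v \in component w x)%:R))).
  apply: ler_sum => s _; rewrite ler_wpM2l ?weight_ge0 // ler_mean // => w.
  exact: mem_explored.
have -> : \sum_s weight q s * mean p (fun w =>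
    \sum_(x in val e) \sum_v (s v)%:R * (v \in component w x)%:R) =
    \sum_(x in val e) q * mean p (fun w => #|component w x|%:R).
  rewrite -[LHS]/(mean q _) (@eq_mean _ _ q _ (fun s => \sum_(x in val e) \sum_v
      mean p (fun w => (v \in component w x)%:R) * ((s v)%:R * 1))); last first.
    move=> s; rewrite mean_sum; apply: eq_bigr => x _; rewrite mean_sum.
    by apply: eq_bigr => v _; rewrite meanZ mulr1 mulrC.
  rewrite mean_sum; apply: eq_bigr => x _; rewrite mean_sum.
  transitivity (\sum_v mean p (fun w => (v \in component w x)%:R) * q).
    apply: eq_bigr => v _; rewrite meanZ.
    rewrite (@mean_coord _ _ q v (fun b => b%:R) (fun=> 1)) // mean_cst.
    by rewrite mulr0 addr0 !mulr1.
  rewrite -mulr_suml mulrC -mean_sum; congr (_ * _); apply: eq_mean => w.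
  exact: sum_mem_card.
apply: (@le_trans _ _ (\sum_(x in val e) q * chi)).
  by apply: ler_sum => x _; rewrite ler_wpM2l.
by rewrite sumr_const (eqP (valP e)) -[leLHS]mulr_natl mulrA.
Qed.

End Sampling.

(** The trade-off: a sampling density [q] costs revealment of order [q * r] and an
error [expR (- (q * theta))] in the approximation. *)
Lemma giant_noise_covariance_le (R : realType) (n : nat) (theta q r rho : R) :
  (1 < n)%N -> 0 < theta -> 0 < q <= 1 -> 0 < r -> r ^+ 3 = n%:R -> 2 <= r ^+ 2 ->
  0 <= rho < 1 ->
  `|noise_stability n%:R^-1 (bern_char n%:R^-1) rho (@giant_indic R n theta) -
    mean n%:R^-1 (@giant_indic R n theta) ^+ 2| <=
  8 * q * r / (1 - rho) ^+ 2 + 2 * expR (- (q * theta)).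
Proof.
move=> n1 theta0 /andP[q0 q1] r0 r3 r2 /andP[rho0 rho1].
set f := giant_indic theta.
set p : R := n%:R^-1; set phi := bern_char p.
have p0 : 0 < p by rewrite invr_gt0 ltr0n ltnW.
have p1 : p < 1 by rewrite invf_lt1 ?ltr1n // ltr0n ltnW.
have p01 : 0 <= p <= 1 by rewrite !ltW.
have q01 : 0 <= q <= 1 by rewrite ltW.
pose g s (w : config n) : R := (hit theta s w)%:R.
pose h := average (weight q) g.
have hE w : h w = mean q (fun s => g s w) by [].
have delta0 : 0 < 8 * q * r by rewrite !mulr_gt0.
have sum1 : \sum_(s : {ffun 'I_n -> bool}) weight q s = 1 :> R.
  by rewrite -[RHS](@mean_cst R 'I_n q 1); apply: eq_bigr => s _; rewrite mulr1.
have cov_h : 0 <= noise_stability p phi rho h - mean p h ^+ 2 <= 8 * q * r / (1 - rho) ^+ 2.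
  apply: (@noise_covariance_le _ _ p phi (bern_char_mean p0 p1) (bern_char_var p0 p1)
    _ _ (weight_ge0 q01) sum1 (@explored n) g) => //.
  - by move=> s w e b eJ; have [-> H] := hit_stopping theta b eJ; rewrite /g H.
  - by move=> s w; rewrite /g; case: hit; rewrite ?expr1n ?expr0n /=.
  - move=> e; have := @revealment_le R n p q (4 * r) e p01 q01.
    have -> : 2 * q * (4 * r) = 8 * q * r by ring.
    by apply => v; apply: mean_component_le.
  - by rewrite rho0.
have gf s w : g s w <= f w.
  rewrite /g /f /giant_indic; case: (boolP (hit theta s w)) => [/hit_giant -> //|_].
  exact: ler0n.
have perturb : `|noise_stability p phi rho f - mean p f ^+ 2 -
    (noise_stability p phi rho h - mean p h ^+ 2)| <= 2 * expR (- (q * theta)).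
  apply: noise_covariance_perturb => //.
  - exact: bern_char_mean.
  - by move=> b b'; apply: bern_density_ge0 => //; rewrite rho0 ltW.
  - by move=> w; rewrite hE mean_ge0 // => s; apply: ler0n.
  - by move=> w; rewrite hE -(mean_cst 'I_n q (f w)) ler_mean.
  - by move=> w; rewrite /f /giant_indic; case: giant.
  move=> w; rewrite hE /f /giant_indic; case: (boolP (giant theta w)) => [gw|_].
    by rewrite lerBlDr -lerBlDl; apply: mean_hit_ge.
  by rewrite sub0r (le_trans _ (expR_ge0 _)) // oppr_le0 mean_ge0 // => s; apply: ler0n.
move: perturb; rewrite !ler_norml => /andP[? ?]; case/andP: cov_h => ? ?.
by apply/andP; split; lra.
Qed.

(** * The law of a configuration and its noisy copy *)

Section NoiseLaw.
Variables (R : realType) (n : nat) (p eps : R).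
Hypothesis p0 : 0 < p.
Hypothesis p1 : p < 1.
Implicit Types (f : config n -> R) (b : bool).

(** What the model uses at one edge: the initial state, whether it is kept, and
the state drawn if it is not. *)
Definition bits : Type := (bool * bool * bool)%type.

Definition bits_weight (c : bits) : R :=
  bern p c.1.1 * bern (1 - eps) c.1.2 * bern p c.2.

Definition noisy_bit (c : bits) : bool := c.1.1 && c.1.2 || c.2 && ~~ c.1.2.

Definition initial_of (z : {ffun edge n -> bits}) : config n := [ffun e => (z e).1.1].

Definition noisy_of (z : {ffun edge n -> bits}) : config n := [ffun e => noisy_bit (z e)].

Lemma pair_law b b' :
  \sum_(c : bits) bits_weight c * ((c.1.1 == b) && (noisy_bit c == b'))%:R =
  bern p b * bern p b' * (1 + (1 - eps) * (bern_char p b * bern_char p b')).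
Proof.
rewrite -(pair_bigA _ (fun c1 c2 => bits_weight (c1, c2) *
  ((c1.1 == b) && (noisy_bit (c1, c2) == b'))%:R)) /=.
rewrite -(pair_bigA _ (fun a k => \sum_c2 bits_weight (a, k, c2) *
  ((a == b) && (noisy_bit (a, k, c2) == b'))%:R)) /=.
rewrite !big_bool /= /noisy_bit /bits_weight /=.
have [->|bb'] := eqVneq b' b.
  rewrite bern_char_sqr //; case: b => /=; field.
    by rewrite gt_eqF.
  by rewrite gt_eqF // subr_gt0.
have {bb'} -> : b' = ~~ b by case: b b' bb' => [] [].
rewrite bern_char_mixed //; case: b => /=; ring.
Qed.

(** The outcomes at one edge that produce the same pair of states are merged, edge
by edge. *)
Lemma pair_expectation (G : config n -> config n -> R) :
  \sum_(z : {ffun edge n -> bits}) (\prod_e bits_weight (z e)) * G (initial_of z) (noisy_of z) =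
  mean p (fun w => mean p (fun w' => noise_density (bern_char p) (1 - eps) w w' * G w w')).
Proof.
pose ind z w w' : R := ((initial_of z == w) && (noisy_of z == w'))%:R.
have law w w' : weight p w * (weight p w' * noise_density (bern_char p) (1 - eps) w w') =
    \sum_(z : {ffun edge n -> bits}) (\prod_e bits_weight (z e)) * ind z w w'.
  rewrite /weight /noise_density -!big_split /=.
  under eq_bigr => e _ do rewrite mulrA -pair_law.
  rewrite bigA_distr_bigA; apply: eq_bigr => z _.
  rewrite big_split /=; congr (_ * _); rewrite /ind -natr_prod; congr _%:R.
  apply/eqP; case: (boolP (_ && _)) => [/andP[/eqP <- /eqP <-]|neq].
    by rewrite big1 // => e _; rewrite !ffunE !eqxx.
  have /existsP[e ze] : [exists e, ~~ (((z e).1.1 == w e) && (noisy_bit (z e) == w' e))].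
    apply: contraR neq => /existsPn same; apply/andP; split; apply/eqP/ffunP => e;
      by have := same e; rewrite negbK ffunE => /andP[/eqP ? /eqP ?].
  by rewrite (bigD1 e) //= (negbTE ze) mul0n.
transitivity (\sum_(z : {ffun edge n -> bits}) \sum_w \sum_w'
    (\prod_e bits_weight (z e)) * ind z w w' * G w w').
  apply: eq_bigr => z _; move: (\prod_e _) => c.
  rewrite (bigD1 (initial_of z)) //= (bigD1 (noisy_of z)) //= /ind !eqxx mulr1.
  rewrite big1 ?addr0 => [|w' ne]; last first.
    by rewrite eq_sym (negbTE ne) mulr0 mul0r.
  rewrite big1 ?addr0 // => w ne; rewrite big1 // => w' _.
  by rewrite eq_sym (negbTE ne) mulr0 mul0r.
rewrite exchange_big; apply: eq_bigr => w _ /=.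
rewrite exchange_big /mean mulr_sumr; apply: eq_bigr => w' _ /=.
by rewrite -mulr_suml -law !mulrA.
Qed.

End NoiseLaw.

Section Model.
Local Open Scope ereal_scope.
Variables (R : realType) (d : measure_display) (T : measurableType d) (P : probability T R).

Lemma uniform_prob_gt (c : R) : (0 <= c <= 1)%R ->
  uniform_prob (@ltr01 R) `]c, +oo[%classic = (1 - c)%:E.
Proof.
move=> /andP[c0 c1]; rewrite /uniform_prob integral_uniform_pdf.
have -> : `]c, +oo[%classic `&` `[0%R, 1%R]%classic = `]c, 1%R]%classic :> set R.
  apply/seteqP; split=> x /=; rewrite !in_itv /= ?andbT.
    by move=> [cx /andP[_ x1]]; rewrite cx x1.
  by move=> /andP[cx x1]; rewrite cx x1 andbT (le_trans c0 (ltW cx)).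
rewrite (eq_integral (cst 1%:E)); last first.
  move=> x; rewrite inE /= in_itv /= => /andP[cx x1].
  by rewrite /uniform_pdf (le_trans c0 (ltW cx)) x1 /= subr0 invr1.
rewrite integral_cst //= mul1e lebesgue_measure_itv /= lte_fin.
by move: c1; rewrite le_eqVlt => /predU1P[->|->]; rewrite ?ltxx ?subrr // EFinB.
Qed.

Lemma uniform_prob_lt (c : R) : (0 <= c <= 1)%R ->
  uniform_prob (@ltr01 R) `]-oo, c[%classic = c%:E.
Proof.
move=> /andP[c0 c1]; rewrite /uniform_prob integral_uniform_pdf.
have -> : `]-oo, c[%classic `&` `[0%R, 1%R]%classic = `[0%R, c[%classic :> set R.
  apply/seteqP; split=> x /=; rewrite !in_itv /=.
    by move=> [cx /andP[x0 _]]; rewrite cx x0.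
  by move=> /andP[x0 cx]; rewrite cx x0 (le_trans (ltW cx) c1).
rewrite (eq_integral (cst 1%:E)); last first.
  move=> x; rewrite inE /= in_itv /= => /andP[x0 cx].
  by rewrite /uniform_pdf x0 (le_trans (ltW cx) c1) /= subr0 invr1.
rewrite integral_cst //= mul1e lebesgue_measure_itv /= lte_fin.
by move: c0; rewrite le_eqVlt => /predU1P[<-|->]; rewrite ?ltxx // oppr0 adde0.
Qed.

Lemma prob_bool (X : T -> bool) (r : R) b : measurable [set t | X t = true] ->
  P [set t | X t = true] = r%:E -> P [set t | X t = b] = (bern r b)%:E.
Proof.
move=> mX PX; case: b => //=.
have -> : [set t | X t = false] = ~` [set t | X t = true].
  by apply/seteqP; split=> t /=; case: (X t).
by rewrite probability_setC // PX EFinB.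
Qed.

Lemma finite_expectation (D : finType) (Z : T -> D) (m : D -> R) (H : D -> R) :
  (forall z, measurable [set t | Z t = z]) ->
  (forall z, P [set t | Z t = z] = (m z)%:E) ->
  (forall z, 0 <= H z)%R ->
  'E_P[fun t => H (Z t)] = (\sum_z m z * H z)%:E.
Proof.
move=> mZ PZ H0; rewrite unlock.
transitivity (\int[P]_t (\sum_(z <- index_enum D) (H z)%:E * (\1_[set t | Z t = z] t)%:E)).
  apply: eq_integral => t _; rewrite (bigD1 (Z t)) //= big1 ?adde0 => [|z zt].
    by rewrite indicE mem_set // mule1.
  by rewrite indicE memNset ?mule0 //= => /esym/eqP; rewrite (negbTE zt).
rewrite ge0_integral_sum //.
- rewrite -sumEFin; apply: eq_bigr => z _.
  rewrite ge0_integralZl_EFin //.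
  + by rewrite integral_indic // setIT mulrC EFinM -PZ.
  + by apply/measurable_EFinP; apply: measurable_indic.
- move=> z; apply: measurable_funeM; apply/measurable_EFinP.
  exact: measurable_indic.
- by move=> z t _; rewrite -EFinM lee_fin mulr_ge0.
Qed.

End Model.

Section ModelLaw.
Local Open Scope ereal_scope.
Variables (R : realType) (n : nat) (p eps : R).
Variables (d : measure_display) (T : measurableType d) (P : probability T R).
Variables (omega : edge n -> {RV P >-> bool}) (U V : edge n -> {RV P >-> R}).
Hypothesis model : resampling_model p omega U V.
Hypothesis p01 : (0 <= p <= 1)%R.
Hypothesis eps01 : (0 <= eps <= 1)%R.

Definition observed (t : T) : {ffun edge n -> bits} :=
  [ffun e => (omega e t, (eps < U e t)%R, (V e t < p)%R)].

Lemma initial_of_observed t : initial_of (observed t) = initial_config omega t.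
Proof. by apply/ffunP => e; rewrite !ffunE. Qed.

Lemma noisy_of_observed t : noisy_of (observed t) = noisy_config p eps omega U V t.
Proof. by apply/ffunP => e; rewrite !ffunE /noisy_bit /= leNgt. Qed.

(** One binary test for each of the independent variables; the model is seen only
through these tests. *)
Definition test (i : edge n + edge n + edge n) (t : T) : bool :=
  match i with
  | inl (inl e) => omega e t
  | inl (inr e) => (eps < U e t)%R
  | inr e => (V e t < p)%R
  end.

Definition test_prob (i : edge n + edge n + edge n) : R :=
  match i with inl (inr _) => 1 - eps | _ => p end.

Definition outcome (z : {ffun edge n -> bits}) (i : edge n + edge n + edge n) : bool :=
  match i with
  | inl (inl e) => (z e).1.1
  | inl (inr e) => (z e).1.2
  | inr e => (z e).2
  end.

Lemma test_sigma i b : (match i with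
    | inl (inl e) => sigma_of (omega e)
    | inl (inr e) => sigma_of (U e)
    | inr e => sigma_of (V e)
    end) [set t | test i t = b].
Proof.
case: i => [[e|e]|e] /=.
- by exists [set b] => //; rewrite setTI.
- exists [set x | (eps < x)%R = b]; last by rewrite setTI.
  rewrite (_ : [set x | _] = if b then `]eps, +oo[%classic else ~` `]eps, +oo[%classic).
    by case: b => //; apply: measurableC.
  by case: b; apply/seteqP; split=> x /=; rewrite in_itv /= andbT; case: (_ < _)%R.
- exists [set x | (x < p)%R = b]; last by rewrite setTI.
  rewrite (_ : [set x | _] = if b then `]-oo, p[%classic else ~` `]-oo, p[%classic).
    by case: b => //; apply: measurableC.
  by case: b; apply/seteqP; split=> x /=; rewrite in_itv /=; case: (_ < _)%R.
Qed.

Lemma measurable_test i b : measurable [set t | test i t = b].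
Proof.
have := test_sigma i b; case: i => [[e|e]|e] /= [B mB <-];
  by apply: measurable_funP.
Qed.

Lemma prob_test i b : P [set t | test i t = b] = (bern (test_prob i) b)%:E.
Proof.
apply: prob_bool; first exact: measurable_test.
have [omega_law U_law V_law _] := model.
case: i => [[e|e]|e] /=.
- exact: omega_law.
- rewrite -uniform_prob_gt // -(U_law e) //; congr (P _).
  by apply/seteqP; split=> t /=; rewrite in_itv /= andbT.
- by rewrite -[RHS]uniform_prob_lt // -(V_law e).
Qed.

Lemma observed_event z : [set t | observed t = z] =
  \bigcap_(i in [set` [set: edge n + edge n + edge n]%SET]) [set t | test i t = outcome z i].
Proof.
apply/seteqP; split=> t /=.
  by move=> <- [[e|e]|e] _ /=; rewrite ffunE.
move=> all_tests; apply/ffunP => e; rewrite ffunE.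
have /= -> := all_tests (inl (inl e)) (finset.in_setT _).
have /= -> := all_tests (inl (inr e)) (finset.in_setT _).
have /= -> := all_tests (inr e) (finset.in_setT _).
by case: (z e) => [[]].
Qed.

Lemma measurable_observed z : measurable [set t | observed t = z].
Proof.
rewrite observed_event; apply: fin_bigcap_measurable => //.
by move=> i _; apply: measurable_test.
Qed.

Lemma prob_observed z :
  P [set t | observed t = z] = (\prod_e bits_weight p eps (z e))%:E.
Proof.
have [_ _ _ indep] := model.
rewrite observed_event indep; last by move=> i _; apply: test_sigma.
rewrite (eq_bigr (fun i => (bern (test_prob i) (outcome z i))%:E)); last first.
  by move=> i _; apply: prob_test.
rewrite prodEFin; congr _%:E.
rewrite (eq_bigl predT); last by move=> i; rewrite finset.in_setT.
rewrite !big_sumType /= -!big_split /=.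
by [].
Qed.

(** The observable depends on finitely many tests, whose joint outcomes have product
probabilities because they lie in independent sigma-algebras. *)
Lemma model_expectation (G : config n -> config n -> R) : (0 < p < 1)%R ->
  (forall w w', 0 <= G w w')%R ->
  'E_P[fun t => G (initial_config omega t) (noisy_config p eps omega U V t)] =
  (mean p (fun w => mean p (fun w' =>
    noise_density (bern_char p) (1 - eps) w w' * G w w')))%:E.
Proof.
move=> /andP[p0 p1] G0; rewrite -pair_expectation //.
rewrite -(finite_expectation measurable_observed prob_observed); last by move=> z; apply: G0.
by congr expectation; apply/funext => t; rewrite initial_of_observed noisy_of_observed.
Qed.

Lemma model_covariance (f : config n -> R) : (0 < p < 1)%R -> (forall w, 0 <= f w)%R ->
  'E_P[fun t => (f (initial_config omega t) * f (noisy_config p eps omega U V t))%R] -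
  'E_P[fun t => f (initial_config omega t)] ^+ 2 =
  (noise_stability p (bern_char p) (1 - eps) f - mean p f ^+ 2)%:E.
Proof.
move=> p01' f0; have /andP[p0 p1] := p01'.
rewrite (@model_expectation (fun w w' => f w * f w')%R) //; last first.
  by move=> w w'; rewrite mulr_ge0.
rewrite (@model_expectation (fun w _ => f w)) //.
rewrite EFinB EFin_expe; congr (_ - (_ ^+ 2)%:E).
apply: eq_mean => w; under eq_mean => w' do rewrite mulrC.
by rewrite meanZ mean_noise_density ?mulr1 //; apply: bern_char_mean.
Qed.

End ModelLaw.

Lemma powR_sixth (R : realType) (x : R) k : 0 <= x ->
  (x `^ (1 / 6)) ^+ k = x `^ (k%:R / 6).
Proof.
by move=> x0; rewrite -powR_mulrn ?powR_ge0 // -powRrM; congr powR; rewrite mulrC mulrA mulr1.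
Qed.

(** * Noise sensitivity *)

(** The sampling density is [K / n ^ (2 / 3)]. The error is then at most
[2 * expR (- (a * K))], small by the choice of [K], and the revealment term is
[8 * K / L ^+ 2] with [L = n ^ (1 / 6) * eps]. The bound assumed on [L] also makes
[n] large enough for the other estimates, because [eps] is at most 1. *)
Lemma giant_noise_covariance_lt (R : realType) (n : nat) (a K e eps : R) :
  0 < a -> 0 < e -> 4 / e <= a * K -> 0 < K -> 0 <= eps <= 1 ->
  2 + K + 16 * K / e <= n%:R `^ (1 / 6) * eps ->
  (1 < n)%N /\
  `|noise_stability n%:R^-1 (bern_char n%:R^-1) (1 - eps)
      (@large_component_indic R a n) -
    mean n%:R^-1 (@large_component_indic R a n) ^+ 2| < e.
Proof.
move=> a0 e0 aK K0 /andP[eps0 eps1] large; set s := n%:R `^ (1 / 6) in large *.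
have s6 : s ^+ 6 = n%:R by rewrite /s powR_sixth // divff // powRr1.
have s4 : n%:R `^ (2 / 3) = s ^+ 4 :> R.
  by rewrite /s powR_sixth //; congr powR; field.
have s0 : 0 <= s by apply: powR_ge0.
have se : s * eps <= s by rewrite ler_piMr.
have Ke0 : 0 < 16 * K / e by rewrite divr_gt0 // mulr_gt0.
have s_ge2 : 2 <= s by lra.
have s_gt0 : 0 < s by lra.
have n1 : (1 < n)%N by rewrite -(ltr_nat R) -s6 exprn_egt1 //; lra.
split=> //.
have eps_gt0 : 0 < eps.
  rewrite lt_neqAle eps0 andbT; apply/eqP => E; move: large.
  by rewrite -E mulr0; lra.
pose r := s ^+ 2; pose q := K / r ^+ 2.
have r0 : 0 < r by rewrite exprn_gt0.
have r4 : 4 <= r by rewrite /r expr2; nra.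
have Kr : K <= r ^+ 2.
  have : s <= r by rewrite /r expr2; nra.
  have : r <= r ^+ 2 by rewrite expr2; nra.
  lra.
have q01 : 0 < q <= 1.
  by rewrite divr_gt0 ?exprn_gt0 //= ler_pdivrMr ?exprn_gt0 // mul1r.
have rho01 : 0 <= 1 - eps < 1 by apply/andP; split; lra.
have theta0 : 0 < a * n%:R `^ (2 / 3) by rewrite s4 mulr_gt0 // exprn_gt0.
have r3 : r ^+ 3 = n%:R by rewrite /r -exprM.
have r2 : 2 <= r ^+ 2 by rewrite expr2; nra.
apply: le_lt_trans (giant_noise_covariance_le n1 theta0 q01 r0 r3 r2 rho01) _.
have -> : q * (a * n%:R `^ (2 / 3)) = a * K.
  by rewrite s4 /q /r; field; rewrite gt_eqF.
have -> : 8 * q * r / (1 - (1 - eps)) ^+ 2 = 8 * K / (s * eps) ^+ 2.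
  by rewrite /q /r; field; rewrite !gt_eqF // opprB addrC subrK.
have tail : expR (- (a * K)) < e / 4.
  rewrite expRN invf_plt ?posrE ?expR_gt0 ?divr_gt0 // invf_div.
  by apply: lt_le_trans (expR_ge1Dx _); lra.
set L := s * eps in large *.
have L0 : 0 < L by lra.
have main : 8 * K / L ^+ 2 < e / 2.
  rewrite ltr_pdivrMr ?exprn_gt0 //.
  have : 16 * K < L * e by rewrite -ltr_pdivrMr //; lra.
  have : L * e <= L ^+ 2 * e by rewrite ler_wpM2r ?(ltW e0) // expr2; nra.
  lra.
lra.
Qed.

Theorem proposition2p2 (R : realType) (a : R) (a_gt0 : 0 < a)
    (eps : nat -> R)
    (eps01 : forall n, (0 < n)%N -> 0 <= eps n <= 1)
    (eps_large : (n%:R `^ (1 / 6) * eps n) @[n --> \oo] --> +oo)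
    (d : nat -> measure_display)
    (T : forall n, measurableType (d n))
    (P : forall n, probability (T n) R)
    (omega : forall n, edge n -> {RV (P n) >-> bool})
    (U V : forall n, edge n -> {RV (P n) >-> R})
    (model : forall n, (0 < n)%N ->
      resampling_model n%:R^-1 (omega n) (U n) (V n)) :
  let F n (w : config n) : R := large_component_indic a w in
  let w0 n := initial_config (omega n) in
  let weps n := noisy_config n%:R^-1 (eps n) (omega n) (U n) (V n) in
  ('E_(P n)[fun t => (F n (w0 n t) * F n (weps n t))%R]
    - 'E_(P n)[fun t => F n (w0 n t)] ^+ 2)%E @[n --> \oo] --> 0%E.
Proof.
move=> F w0 weps.
pose cov n := noise_stability n%:R^-1 (bern_char n%:R^-1) (1 - eps n) (F n) -
  mean n%:R^-1 (F n) ^+ 2.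
have covE n : (1 < n)%N -> ('E_(P n)[fun t => (F n (w0 n t) * F n (weps n t))%R]
    - 'E_(P n)[fun t => F n (w0 n t)] ^+ 2)%E = (cov n)%:E.
  move=> n1; have n0 := ltnW n1.
  have p01 : 0 < (n%:R^-1 : R) < 1.
    by rewrite invr_gt0 ltr0n n0 invf_lt1 ?ltr1n // ltr0n.
  apply: (@model_covariance _ _ _ _ _ _ _ _ _ _ (model n n0) _ _ (F n)) => //.
  - by case/andP: p01 => *; rewrite !ltW.
  - exact: eps01.
have cov0 : cov n @[n --> \oo] --> (0 : R).
  apply/cvgr0Pnorm_lt => e e0.
  pose K := 4 / e / a.
  have K0 : 0 < K by rewrite !divr_gt0.
  have aK : 4 / e <= a * K by rewrite /K [a * _]mulrC divfK ?gt_eqF.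
  have /cvgryPge/(_ (2 + K + 16 * K / e)) := eps_large.
  apply: filterS2 (nbhs_infty_gt 0) => n n0 large.
  by have [] := giant_noise_covariance_lt a_gt0 e0 aK K0 (eps01 n n0) large.
have covE0 : (cov n)%:E @[n --> \oo] --> 0%E.
  by apply: cvg_EFin => //; apply: nearW.
apply: cvg_trans covE0; apply: near_eq_cvg; near=> n.
by rewrite covE //; near: n; apply: nbhs_infty_gt.
Unshelve. all: by end_near. Qed.
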